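(* Let $\mathbb{A}_1+b_1\subsetneq\cdots\subsetneq\mathbb{A}_k+b_k$ be an affine flag in $\mathbb{R}^n$ with $\dim(\mathbb{A}_j+b_j)=d_j$, where $1\le d_1<d_2<\cdots<d_k\le n$, and let $\Psi(d_1,\dots,d_k)$ denote its affine Schubert variety (which up to isomorphism depends only on $d_1,\dots,d_k$). Then \[ \dim\Psi(d_1,\dots,d_k)=\sum_{j=1}^k d_j-\frac{k(k+1)}{2}+(d_1-1). \]
   Context: $\mathrm{Graff}(k,n)$ is the set (algebraic variety) of $k$-dimensional affine subspaces of $\mathbb{R}^n$. For an affine flag (strictly increasing nested sequence of affine subspaces) $\mathbb{A}_1+b_1\subseteq\cdots\subseteq\mathbb{A}_k+b_k$ in $\mathbb{R}^n$, its affine Schubert variety is $\Psi(\mathbb{A}_1+b_1,\dots,\mathbb{A}_k+b_k)=\{\mathbb{B}+c\in\mathrm{Graff}(k,n):\dim((\mathbb{B}+c)\cap(\mathbb{A}_j+b_j))\ge j,\ j=1,\dots,k\}$; the dimension of an empty intersection is taken to be $-\infty$ (or $-1$). *)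

(* Defs.v *)
From HB Require Import structures.
From mathcomp Require Import all_boot all_order all_algebra.
From mathcomp Require Import reals.
From mathcomp Require Import mpoly.

Set Implicit Arguments.
Unset Strict Implicit.
Unset Printing Implicit Defensive.

Import GRing.Theory Num.Theory.
Local Open Scope ring_scope.

Section AffineSchubert.
Variable R : realType.

Definition affsp n (M : 'M[R]_n) (b : 'rV[R]_n) (x : 'rV[R]_n) : Prop :=
  (x - b <= M)%MS.

(* dim((rowspace M + b) ∩ (rowspace M' + b')) >= j, with the convention that
   the empty set has dimension -oo: the intersection is nonempty, and then it
   equals p + (rowspace M ∩ rowspace M') for any common point p. *)
Definition cap_dim_ge n (M : 'M[R]_n) (b : 'rV[R]_n)
    (M' : 'M[R]_n) (b' : 'rV[R]_n) (j : nat) : Prop :=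
  exists p : 'rV[R]_n,
    [/\ affsp M b p, affsp M' b' p & (j <= \rank (M :&: M')%MS)%N].

(* Standard embedding: the affine k-plane  B + c  corresponds to the pair
   (P, v) where P is the (symmetric, idempotent, rank k) orthogonal projection
   matrix onto B and v is the foot of the perpendicular from the origin
   (v P = 0); the plane is then  rowspace(P) + v. *)
Definition graff_pt (k n : nat) (P : 'M[R]_n) (v : 'rV[R]_n) : Prop :=
  [/\ P^T = P, P *m P = P, \rank P = k & v *m P = 0].

Definition graff_coords n (P : 'M[R]_n) (v : 'rV[R]_n) : 'I_(n * n + n) -> R :=
  fun i => row_mx (mxvec P) v 0 i.

Definition affine_schubert (k n : nat) (A : nat -> 'M[R]_n) (b : nat -> 'rV[R]_n)
    : ('I_(n * n + n) -> R) -> Prop :=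
  fun x => exists (P : 'M[R]_n) (v : 'rV[R]_n),
    [/\ graff_pt k P v, x = graff_coords P v &
        forall j, (1 <= j <= k)%N -> cap_dim_ge P v (A j) (b j) j].

Definition vanishing_ideal N (S : ('I_N -> R) -> Prop) : {mpoly R[N]} -> Prop :=
  fun p => forall x, S x -> p.@[x] = 0.

Definition prime_ideal N (I : {mpoly R[N]} -> Prop) : Prop :=
  [/\ I 0, (forall p q, I p -> I q -> I (p + q)),
      (forall p q, I q -> I (p * q)), ~ I 1 &
      (forall p q, I (p * q) -> I p \/ I q)].

(* A chain C 0 ⊊ C 1 ⊊ ... ⊊ C m of prime ideals containing J, i.e. a chain
   of length m of prime ideals of R[x]/J. *)
Definition prime_chain N (J : {mpoly R[N]} -> Prop) (m : nat)
    (C : nat -> {mpoly R[N]} -> Prop) : Prop :=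
  [/\ (forall i, (i <= m)%N -> prime_ideal (C i)),
      (forall p, J p -> C 0%N p) &
      (forall i, (i < m)%N ->
         (forall p, C i p -> C i.+1 p) /\ (exists p, C i.+1 p /\ ~ C i p))].

Definition krull_dim_is N (J : {mpoly R[N]} -> Prop) (d : nat) : Prop :=
  (exists C, prime_chain J d C) /\
  (forall m C, prime_chain J m C -> (m <= d)%N).

(* Dimension of the real algebraic set S (Krull dimension of its coordinate
   ring R[x]/I(S), as in Bochnak–Coste–Roy). *)
Definition variety_dim_is N (S : ('I_N -> R) -> Prop) (d : nat) : Prop :=
  krull_dim_is (vanishing_ideal S) d.

End AffineSchubert.

(* Main.v *)
Require Import Defs.
From HB Require Import structures.
From mathcomp Require Import all_boot all_order all_algebra.
From mathcomp Require Import reals.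
From mathcomp Require Import mpoly.
From mathcomp Require Import boolp.
From mathcomp Require Import zify ring.
Import GRing.Theory Num.Theory.
Local Open Scope ring_scope.

(** An element of the Schubert variety is P = orthogonal projection onto B
    and v = foot of the perpendicular.  In a basis G adapted to the flag, B has
    a basis whose matrix T is a staircase: row j lives in the first d_j columns,
    has a pivot 1, and vanishes at the pivots of the earlier rows.  Its d_j - j
    other entries are free; a point of B + c in the smallest flag member can be
    moved along row 1 of T so as to vanish at the first pivot, which leaves
    d_1 - 1 more parameters.  So the variety is a finite union, over the choices
    of pivots, of images of R^D under rational maps without poles.

    Upper bound: picking f_i in C_(i+1) outside C_i along a chain of primes of
    length m gives m elements algebraically independent on the variety.  Their
    (N+1)^m monomials with exponents <= N pull back, after clearing
    denominators, into spaces of polynomials of total dimension O(N^D), so m <= D.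

    Lower bound: for the rightmost pivots the parameters t_a are recovered
    rationally from (P, v), so the ideals of the images of {t_a = 0, a < i},
    i = 0..D, form a strict chain of primes. *)

Set Implicit Arguments.
Unset Strict Implicit.
Unset Printing Implicit Defensive.

(** * Polynomial functions and pole-free rational maps *)

Section PolynomialFunctions.
Variables (R : realType) (D : nat).
Implicit Types (f g : ('I_D -> R) -> R).

Definition polyfun f := exists p : {mpoly R[D]}, forall t, f t = p.@[t].

Lemma polyfun_ext f g : f =1 g -> polyfun g -> polyfun f.
Proof. by move=> fg [p gp]; exists p => t; rewrite fg. Qed.

Lemma polyfunC c : polyfun (fun=> c).
Proof. by exists c%:MP => t; rewrite mevalC. Qed.

Lemma polyfunX i : polyfun (fun t => t i).
Proof. by exists 'X_i => t; rewrite mevalXU. Qed.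

Lemma polyfunD f g : polyfun f -> polyfun g -> polyfun (fun t => f t + g t).
Proof. by move=> [p fp] [q gq]; exists (p + q) => t; rewrite mevalD fp gq. Qed.

Lemma polyfunM f g : polyfun f -> polyfun g -> polyfun (fun t => f t * g t).
Proof. by move=> [p fp] [q gq]; exists (p * q) => t; rewrite mevalM fp gq. Qed.

Lemma polyfunN f : polyfun f -> polyfun (fun t => - f t).
Proof. by move=> [p fp]; exists (- p) => t; rewrite mevalN fp. Qed.

Lemma polyfunB f g : polyfun f -> polyfun g -> polyfun (fun t => f t - g t).
Proof. by move=> fp gp; apply: polyfunD => //; apply: polyfunN. Qed.

Lemma polyfun_sum (I : Type) (r : seq I) (P : pred I) (F : I -> ('I_D -> R) -> R) :
  (forall i, P i -> polyfun (F i)) ->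
  polyfun (fun t => \sum_(i <- r | P i) F i t).
Proof.
move=> FP; elim: r => [|i r IHr].
  by apply: polyfun_ext (polyfunC 0) => t; rewrite big_nil.
case Pi: (P i); last by apply: polyfun_ext IHr => t; rewrite big_cons Pi.
by apply: polyfun_ext (polyfunD (FP i Pi) IHr) => t; rewrite big_cons Pi.
Qed.

Lemma polyfun_prod (I : Type) (r : seq I) (P : pred I) (F : I -> ('I_D -> R) -> R) :
  (forall i, P i -> polyfun (F i)) ->
  polyfun (fun t => \prod_(i <- r | P i) F i t).
Proof.
move=> FP; elim: r => [|i r IHr].
  by apply: polyfun_ext (polyfunC 1) => t; rewrite big_nil.
case Pi: (P i); last by apply: polyfun_ext IHr => t; rewrite big_cons Pi.
by apply: polyfun_ext (polyfunM (FP i Pi) IHr) => t; rewrite big_cons Pi.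
Qed.

Lemma polyfunXn f n : polyfun f -> polyfun (fun t => f t ^+ n).
Proof.
move=> fp; elim: n => [|n IHn].
  by apply: polyfun_ext (polyfunC 1) => t; rewrite expr0.
by apply: polyfun_ext (polyfunM fp IHn) => t; rewrite exprS.
Qed.

Definition polymx m n (F : ('I_D -> R) -> 'M[R]_(m, n)) :=
  forall i j, polyfun (fun t => F t i j).

Lemma polymxC m n (A : 'M[R]_(m, n)) : polymx (fun=> A).
Proof. by move=> i j; apply: polyfunC. Qed.

Lemma polymx_ext m n (F G : ('I_D -> R) -> 'M[R]_(m, n)) :
  F =1 G -> polymx G -> polymx F.
Proof. by move=> FG Gp i j; apply: polyfun_ext (Gp i j) => t; rewrite FG. Qed.

Lemma polymx_mul m n p (F : ('I_D -> R) -> 'M[R]_(m, n))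
    (G : ('I_D -> R) -> 'M[R]_(n, p)) :
  polymx F -> polymx G -> polymx (fun t => F t *m G t).
Proof.
move=> Fp Gp i j.
apply: (@polyfun_ext _ (fun t => \sum_l F t i l * G t l j)) => [t|].
  by rewrite mxE.
by apply: polyfun_sum => l _; apply: polyfunM.
Qed.

Lemma polymxD m n (F G : ('I_D -> R) -> 'M[R]_(m, n)) :
  polymx F -> polymx G -> polymx (fun t => F t + G t).
Proof.
move=> Fp Gp i j.
by apply: polyfun_ext (polyfunD (Fp i j) (Gp i j)) => t; rewrite mxE.
Qed.

Lemma polymxB m n (F G : ('I_D -> R) -> 'M[R]_(m, n)) :
  polymx F -> polymx G -> polymx (fun t => F t - G t).
Proof.
move=> Fp Gp i j.
by apply: polyfun_ext (polyfunB (Fp i j) (Gp i j)) => t; rewrite !mxE.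
Qed.

Lemma polymxZ m n f (G : ('I_D -> R) -> 'M[R]_(m, n)) :
  polyfun f -> polymx G -> polymx (fun t => f t *: G t).
Proof.
by move=> fp Gp i j; apply: polyfun_ext (polyfunM fp (Gp i j)) => t; rewrite mxE.
Qed.

Lemma polymx_tr m n (F : ('I_D -> R) -> 'M[R]_(m, n)) :
  polymx F -> polymx (fun t => (F t)^T).
Proof. by move=> Fp i j; apply: polyfun_ext (Fp j i) => t; rewrite mxE. Qed.

Lemma polymx_sub m n m' n' (F : ('I_D -> R) -> 'M[R]_(m, n)) (r : 'I_m' -> 'I_m)
    (c : 'I_n' -> 'I_n) : polymx F -> polymx (fun t => mxsub r c (F t)).
Proof. by move=> Fp i j; apply: polyfun_ext (Fp (r i) (c j)) => t; rewrite mxE. Qed.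

Lemma polyfun_det n (F : ('I_D -> R) -> 'M[R]_n) :
  polymx F -> polyfun (fun t => \det (F t)).
Proof.
move=> Fp; apply: polyfun_sum => s _; apply: polyfunM; first exact: polyfunC.
by apply: polyfun_prod => i _.
Qed.

Lemma polymx_adj n (F : ('I_D -> R) -> 'M[R]_n) :
  polymx F -> polymx (fun t => \adj (F t)).
Proof.
move=> Fp i j; apply: (@polyfun_ext _ (fun t => cofactor (F t) j i)) => [t|].
  by rewrite mxE.
apply: polyfunM; first exact: polyfunC.
apply: polyfun_det => a b.
by apply: polyfun_ext (Fp (lift j a) (lift i b)) => t; rewrite !mxE.
Qed.

(** Substituting the affine parametrisation into every monomial leaves a polynomial in [s], so
    nonvanishing on R^D reduces to counting roots on a line. *)
Lemma polyfun_line f (t0 t1 : 'I_D -> R) : polyfun f ->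
  exists p : {poly R}, forall s, f (fun i => t0 i + s * (t1 i - t0 i)) = p.[s].
Proof.
move=> [p fp].
exists (\sum_(m <- msupp p) p@_m *:
          \prod_i ((t0 i)%:P + 'X * (t1 i - t0 i)%:P) ^+ m i) => s.
rewrite fp mevalE horner_sum; apply: eq_bigr => m _.
rewrite hornerZ horner_prod; congr (_ * _); apply: eq_bigr => i _.
by rewrite horner_exp !hornerE.
Qed.

End PolynomialFunctions.

(** A nonzero [p] has fewer than [size p] roots, while 0, ..., [size p] - 1 are distinct in
    characteristic zero. *)
Lemma poly_nonroot (R : numDomainType) (p : {poly R}) :
  p != 0 -> exists s, p.[s] != 0.
Proof.
move=> p0; pose rs := [seq i%:R : R | i <- iota 0 (size p)].
have: ~~ all (root p) rs.
  have urs : uniq rs.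
    rewrite map_inj_uniq ?iota_uniq // => i j /eqP.
    by rewrite eqr_nat => /eqP.
  apply/negP => /(max_poly_roots p0)/(_ urs).
  by rewrite size_map size_iota ltnn.
by case/allPn=> s _ ps; exists s.
Qed.

(* Two functions that do not vanish identically, restricted to the line
   through points where each is nonzero, become nonzero univariate
   polynomials. *)
Lemma polyfun_common_nonzero (R : realType) D (f g : ('I_D -> R) -> R) t0 t1 :
  polyfun f -> polyfun g -> f t0 != 0 -> g t1 != 0 ->
  exists s, let t := fun i => t0 i + s * (t1 i - t0 i) in f t != 0 /\ g t != 0.
Proof.
move=> fp gp f0 g1.
have [p fE] := polyfun_line t0 t1 fp; have [q gE] := polyfun_line t0 t1 gp.
have p0 : p != 0.
  apply: contraNneq f0 => p0; move: (fE 0); rewrite p0 horner0 => <-.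
  by apply/eqP; congr f; apply: funext => i; rewrite mul0r addr0.
have q0 : q != 0.
  apply: contraNneq g1 => q0; move: (gE 1); rewrite q0 horner0 => <-.
  by apply/eqP; congr g; apply: funext => i; rewrite mul1r addrC subrK.
have [s] := poly_nonroot (mulf_neq0 p0 q0).
by rewrite hornerM mulf_eq0 negb_or -fE -gE => /andP[? ?]; exists s.
Qed.

Section RationalMaps.
Variables (R : realType) (D N : nat).

(** One denominator [q] serves all coordinates; as it has no zero, [phi] is defined on the whole of
    R^D. *)
Definition ratmap (phi : ('I_D -> R) -> 'I_N -> R) (q : ('I_D -> R) -> R) :=
  [/\ polyfun q, (forall t, q t != 0) &
      forall i, polyfun (fun t => q t * phi t i)].

(** A monomial of degree e < r absorbs q^e, one factor per variable, and leaves the polynomial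
    factor q^(r - e). *)
Lemma ratmap_meval phi q (p : {mpoly R[N]}) r : ratmap phi q -> (msize p <= r)%N ->
  polyfun (fun t => q t ^+ r * p.@[phi t]).
Proof.
move=> [qp q0 phip] pr.
apply: (@polyfun_ext _ _ _ (fun t => \sum_(m <- msupp p | m \in msupp p)
   p@_m * (q t ^+ (r - mdeg m) * \prod_i (q t * phi t i) ^+ m i))) => [t|].
  rewrite mevalE big_distrr /= big_seq; apply: eq_bigr => m mp.
  rewrite mulrCA; congr (_ * _).
  under [in RHS]eq_bigr do rewrite exprMn.
  rewrite big_split /= mulrA; congr (_ * _).
  rewrite prodrXr -mdegE -exprD subnK //.
  by apply: leq_trans pr; apply: ltnW; apply: msize_mdeg_lt.
apply: polyfun_sum => m _; apply: polyfunM; first exact: polyfunC.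
apply: polyfunM; first exact: polyfunXn.
by apply: polyfun_prod => i _; apply: polyfunXn.
Qed.

(** Let L_i be the linear space t_a = 0, a < i. The ideal of its image is prime because L_i contains
    the line through any two of its points. The inclusions are strict because [u i] vanishes on the
    image of L_(i+1) but not at the image of the i-th unit vector, which lies in L_i. *)
Lemma ratmap_chain phi q (S : ('I_N -> R) -> Prop) (u : 'I_D -> {mpoly R[N]}) w :
  ratmap phi q -> (forall t, S (phi t)) -> (forall t, w t != 0) ->
  (forall i t, (u i).@[phi t] = w t * t i) ->
  exists C, prime_chain (vanishing_ideal S) D C.
Proof.
move=> phiP phiS w0 uE.
exists (fun i (p : {mpoly R[N]}) => forall t : 'I_D -> R,
  (forall a : 'I_D, (a < i)%N -> t a = 0) -> p.@[phi t] = 0).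
have q0 t : q t != 0 by case: phiP.
split.
- move=> i _; split.
  + by move=> t _; rewrite meval0.
  + by move=> f g fP gP t tP; rewrite mevalD fP // gP // addr0.
  + by move=> f g gP t tP; rewrite mevalM gP // mulr0.
  + move=> /(_ (fun=> 0) (fun _ _ => erefl)) /eqP.
    by rewrite meval1 oner_eq0.
  + move=> f g fgP; apply: contrapT => /not_orP[].
    move=> /existsNP[t0 /not_implyP[t0P /eqP f0]].
    move=> /existsNP[t1 /not_implyP[t1P /eqP g1]].
    have [||s [fs gs]] := polyfun_common_nonzero (t0 := t0) (t1 := t1)
      (ratmap_meval phiP (leqnn (msize f))) (ratmap_meval phiP (leqnn (msize g))).
    * by rewrite mulf_neq0 ?expf_neq0.
    * by rewrite mulf_neq0 ?expf_neq0.
    set t := (fun i : 'I_D => _) in fs gs.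
    (* The point [t] is on the line through [t0] and [t1], hence still in L_i. *)
    have /eqP : (f * g).@[phi t] = 0.
      by apply: fgP => a ai; rewrite /t t0P // t1P // subrr mulr0 addr0.
    move: fs gs; rewrite mevalM !mulf_eq0 !negb_or.
    by move=> /andP[_ /negPf->] /andP[_ /negPf->].
- by move=> p pS t _; apply: pS.
- move=> i iD; split=> [p pP t tP|].
    by apply: pP => a ai; apply: tP; rewrite ltnW.
  exists (u (Ordinal iD)); split=> [t tP|/(_ (fun a => (a == Ordinal iD)%:R))].
    by rewrite uE tP ?mulr0.
  rewrite uE eqxx mulr1 => /(_ _)/eqP; rewrite (negPf (w0 _)) => P.
  have // : false by apply: P => a ai; case: eqP ai => // ->; rewrite ltnn.
Qed.

End RationalMaps.

(** * Chains of primes over a union of rational images *)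

Section Monomials.
Variable N : nat.

(** Iterated pairs, so that induction on [m] splits off the exponent of h_0. *)
Fixpoint exponents (m : nat) : finType :=
  if m is m'.+1 then ('I_N.+1 * exponents m')%type : finType else unit.

Lemma card_exponents m : #|exponents m| = (N.+1 ^ m)%N.
Proof.
elim: m => [|m IHm] /=; first by rewrite card_unit.
by rewrite card_prod card_ord IHm expnS.
Qed.

(* The monomial h_0^e_0 ... h_(m-1)^e_(m-1), homogenised by q so that it has
   degree N in each pair (h_i, q). *)
Fixpoint monomial (A : comNzRingType) (q : A) m (h : nat -> A) :
    exponents m -> A :=
  if m is m'.+1 return exponents m -> A then
    fun e => h 0%N ^+ e.1 * q ^+ (N - e.1) * monomial q (fun i => h i.+1) e.2
  else fun=> 1.

Lemma monomial_rmorph (A B : comNzRingType) (f : {rmorphism A -> B}) q m h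
    (e : exponents m) :
  f (monomial q h e) = monomial (f q) (fun i => f (h i)) e.
Proof.
elim: m h e => [|m IHm] h e /=; first by rewrite rmorph1.
by rewrite !rmorphM !rmorphXn IHm.
Qed.

Lemma monomial_eq (A : comNzRingType) (q : A) m (h h' : nat -> A)
    (e : exponents m) :
  (forall i, (i < m)%N -> h i = h' i) -> monomial q h e = monomial q h' e.
Proof.
elim: m h h' e => [|m IHm] h h' e //= hh'; rewrite hh' //.
by congr (_ * _); apply: IHm => i im; apply: hh'.
Qed.

(** Each of the [m] pairs has degree N, so every monomial scales by the same power of [a]. With [q]
    = 1 and [a] a denominator, all monomials are cleared by one common factor. *)
Lemma monomial_scale (A : comNzRingType) (a q : A) m (h : nat -> A)
    (e : exponents m) :
  monomial (a * q) (fun i => a * h i) e = a ^+ (N * m) * monomial q h e.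
Proof.
elim: m h e => [|m IHm] h e /=; first by rewrite muln0 mul1r.
rewrite IHm !exprMn mulnS exprD.
have -> : a ^+ N = a ^+ e.1 * a ^+ (N - e.1).
  by rewrite -exprD subnKC // -ltnS ltn_ord.
move: (a ^+ e.1) (a ^+ (N - e.1)) (a ^+ (N * m)) => x y z.
move: (h 0%N ^+ e.1) (q ^+ (N - e.1)) (monomial _ _ _) => u v w.
by ring.
Qed.

End Monomials.

Section Degree.
Variables (R : realType) (n : nat).
Implicit Types p q : {mpoly R[n]}.

(** [msize] is the degree plus one, and 0 for the zero polynomial; bounds written as successors add
    up like degrees in both cases. *)
Lemma msizeM_leS p q a b :
  (msize p <= a.+1)%N -> (msize q <= b.+1)%N -> (msize (p * q) <= (a + b).+1)%N.
Proof.
have [->|p0] := eqVneq p 0; first by rewrite mul0r msize0.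
have [->|q0] := eqVneq q 0; first by rewrite mulr0 msize0.
move=> pa qb; rewrite msizeM // -subn1 leq_subLR add1n -addnS -addSn.
exact: leq_add.
Qed.

Lemma msizeXn_leS p a r :
  (msize p <= a.+1)%N -> (msize (p ^+ r) <= (r * a).+1)%N.
Proof.
move=> pa; elim: r => [|r IHr]; first by rewrite expr0 msize1.
by rewrite exprS mulSn; apply: msizeM_leS.
Qed.

Lemma msize_monomial N m (h : nat -> {mpoly R[n]}) q a (e : exponents N m) :
  (forall i, (i < m)%N -> (msize (h i) <= a.+1)%N) -> (msize q <= a.+1)%N ->
  (msize (monomial q h e) <= (N * a * m).+1)%N.
Proof.
elim: m h e => [|m IHm] h e /= ha qa; first by rewrite msize1.
rewrite mulnS; apply: msizeM_leS; last by apply: IHm => // i im; apply: ha.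
have eN : (e.1 <= N)%N by rewrite -ltnS ltn_ord.
rewrite -[X in (X * a)%N](subnKC eN) mulnDl.
by apply: msizeM_leS; apply: msizeXn_leS => //; apply: ha.
Qed.

(** Each exponent of a multi-index of degree < b is itself < b, so multi-indices inject into the
    functions from ['I_n] to ['I_b]. *)
Lemma card_bmultinom_leq b : (#|{: 'X_{1..n < b}}| <= b ^ n)%N.
Proof.
case: b => [|b].
  by rewrite (@eq_card0 {: 'X_{1..n < 0}}) // => m; case: (m : 'X_{1..n < 0}).
have -> : (b.+1 ^ n = #|{: {ffun 'I_n -> 'I_b.+1}}|)%N.
  by rewrite card_ffun !card_ord.
pose F (m : 'X_{1..n < b.+1}) : {ffun 'I_n -> 'I_b.+1} := [ffun i => inord (m i)].
apply: (@leq_card _ _ F) => m1 m2 /ffunP F12.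
apply/val_inj/mnmP => i; move: (F12 i); rewrite !ffunE => /(congr1 val) /=.
have mb (m : 'X_{1..n < b.+1}) : (m i < b.+1)%N.
  by apply: leq_ltn_trans (bmdeg m); rewrite mdegE (bigD1 i) //= leq_addr.
by rewrite !inordK.
Qed.

End Degree.

(** A homogeneous linear system with more unknowns than equations has a nonzero solution. *)
Lemma wide_kernel (F : fieldType) (I J : finType) (W : I -> J -> F) :
  (#|J| < #|I|)%N ->
  exists2 c : I -> F, (exists i, c i != 0) & forall j, \sum_i c i * W i j = 0.
Proof.
move=> JI; pose A : 'M[F]_(#|I|, #|J|) := \matrix_(i, j) W (enum_val i) (enum_val j).
have: kermx A != 0.
  rewrite -mxrank_eq0 mxrank_ker subn_eq0 -ltnNge.
  by apply: leq_ltn_trans JI; apply: rank_leq_col.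
case/rowV0Pn => v /sub_kermxP vA v0.
exists (fun i => v 0 (enum_rank i)).
  by case/rV0Pn: v0 => i vi; exists (enum_val i); rewrite enum_valK.
move=> j; move/matrixP/(_ 0 (enum_rank j)): vA; rewrite !mxE => vAj.
rewrite -[RHS]vAj.
rewrite (reindex _ (onW_bij _ (@enum_val_bij I))) /=.
by apply: eq_bigr => i _; rewrite !mxE enum_valK enum_rankK.
Qed.

Section PrimeChains.
Variables (R : realType) (M : nat).

(* If a is the least exponent of f_0 with a nonzero coefficient polynomial G_a,
   primality cancels f_0^a and leaves G_a in C 1, as f_0 is in C 1. *)
Lemma prime_chain_independent N m (C : nat -> {mpoly R[M]} -> Prop) f
    (c : exponents N m -> R) :
  (forall i, (i <= m)%N -> prime_ideal (C i)) ->
  (forall i, (i < m)%N -> forall p, C i p -> C i.+1 p) ->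
  (forall i, (i < m)%N -> C i.+1 (f i) /\ ~ C i (f i)) ->
  C 0%N (\sum_e c e *: monomial 1 f e) -> forall e, c e = 0.
Proof.
elim: m C f c => [|m IHm] C f c Cprime Csub Cf C0 e.
  (* The only monomial is 1, and a nonzero constant in [C 0] would put 1 there. *)
  case: e; move: C0; rewrite (big_pred1 tt) /=; last by case.
  case: (Cprime 0%N isT) => _ _ CM C1 _ C0; apply: contra_notP C1 => /eqP c0.
  by have := CM (c tt)^-1%:MP _ C0; rewrite mul_mpolyC scalerA mulVf // scale1r.
pose G a := \sum_e c (a, e) *: monomial 1 (fun i => f i.+1) e.
have {}C0 : C 0%N (\sum_(a < N.+1) f 0%N ^+ a * G a).
  congr (C _ _) : C0; rewrite /G.
  under [RHS]eq_bigr do rewrite big_distrr.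
  rewrite pair_bigA /=; apply: eq_bigr => -[a e'] _ /=.
  by rewrite expr1n mulr1 scalerAr.
have [I0 ID IM I1 IP] := Cprime 0%N isT.
have [J0 JD JM J1 _] := Cprime 1%N isT.
have [f1 f0] := Cf 0%N isT.
have C01 := Csub 0%N isT.
have step a : C 1%N (G a) -> forall e, c (a, e) = 0.
  apply: (IHm (fun i => C i.+1)) => [i im|i im|i im].
  - exact: Cprime.
  - exact: Csub.
  - exact: Cf.
suff {e} Ga (a : 'I_N.+1) : forall e, c (a, e) = 0 by case: e => a e; apply: Ga.
(* Strong induction on [a]: the coefficient polynomials of lower index are already zero. *)
have [r] := ubnP a; elim: r a => // r IHr a ar; apply: step.
have G0 (b : 'I_N.+1) : (b < a)%N -> G b = 0.
  move=> ba; rewrite /G big1 // => e' _; rewrite IHr ?scale0r //.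
  exact: leq_trans ba _.
(* The terms of index above [a], divided by f_0^(a+1). *)
pose H := \sum_(b < N.+1 | (a < b)%N) f 0%N ^+ (b - a.+1) * G b.
have E : \sum_(b < N.+1) f 0%N ^+ b * G b = f 0%N ^+ a * (G a + H * f 0%N).
  rewrite (bigID (fun b : 'I_N.+1 => (b < a)%N)) /= big1 ?add0r; last first.
    by move=> b ba; rewrite G0 ?mulr0.
  rewrite (bigD1 a) ?ltnn //= mulrDr; congr (_ + _).
  rewrite /H big_distrl big_distrr /=; apply: eq_big => b.
    by rewrite -leqNgt ltn_neqAle eq_sym andbC -val_eqE.
  rewrite -leqNgt => /andP[ab nab].
  have {}ab : (a < b)%N by rewrite ltn_neqAle ab andbT eq_sym.
  rewrite mulrAC mulrA -exprSr -subSn // subSS -exprD subnKC // ltnW //.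
move: C0; rewrite E => /IP[|GH].
  elim: (a : nat) => [|s IHs]; first by rewrite expr0.
  by rewrite exprS => /IP[].
have -> : G a = (G a + H * f 0%N) + (- H) * f 0%N by rewrite mulNr addrK.
by apply: JD; [apply: C01 | apply: JM].
Qed.

(** If m > D, for large N there are more monomials than coefficients in their pullbacks to all the
    charts. A linear relation between the pullbacks is then a relation modulo the vanishing ideal,
    hence modulo [C 0], against independence. *)
Lemma prime_chain_leq (S : ('I_M -> R) -> Prop) (J : finType) (E : J -> nat) D
    (phi : forall j, ('I_(E j) -> R) -> 'I_M -> R) q m C :
  (forall j, ratmap (phi j) (q j)) -> (forall j, (E j <= D)%N) ->
  (forall x, S x -> exists j t, x = phi j t) ->
  prime_chain (vanishing_ideal S) m C -> (m <= D)%N.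
Proof.
move=> phiP ED SP [Cprime CS Cchain]; rewrite leqNgt; apply/negP => Dm.
have [f fP] : exists f : nat -> {mpoly R[M]},
    forall i, (i < m)%N -> C i.+1 (f i) /\ ~ C i (f i).
  have [f fP] : exists f : 'I_m -> {mpoly R[M]},
      forall i : 'I_m, C i.+1 (f i) /\ ~ C i (f i).
    apply: (@fin_all_exists _ (fun=> {mpoly R[M]})
      (fun (i : 'I_m) p => C i.+1 p /\ ~ C i p)) => i.
    by case: (Cchain i (ltn_ord i)).
  exists (fun i => if insub i is Some i' then f i' else 0) => i im.
  by rewrite insubT; have := fP (Ordinal im).
(* One power of [q j] that clears the denominators of every [f i]. *)
pose r := \max_(i < m) msize (f i).
have [Q QP] : exists Q : forall j, {mpoly R[E j]},
    forall j t, q j t ^+ r = (Q j).@[t].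
  apply: (@fin_all_exists J (fun j => {mpoly R[E j]})
    (fun j Q => forall t, q j t ^+ r = Q.@[t])) => j.
  by apply: polyfunXn; case: (phiP j).
have [h hP] : exists h : forall j, 'I_m -> {mpoly R[E j]},
    forall j (i : 'I_m) t, q j t ^+ r * (f i).@[phi j t] = (h j i).@[t].
  apply: (@fin_all_exists J (fun j => 'I_m -> {mpoly R[E j]})
    (fun j h => forall (i : 'I_m) t, q j t ^+ r * (f i).@[phi j t] = (h i).@[t])) => j.
  apply: (@fin_all_exists _ (fun=> {mpoly R[E j]})
    (fun (i : 'I_m) h => forall t, q j t ^+ r * (f i).@[phi j t] = h.@[t])) => i.
  by apply: ratmap_meval (phiP j) _; exact: (leq_bigmax i).
pose h' j i := if insub i is Some i' then h j i' else 0.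
pose a := \max_j maxn (msize (Q j)) (\max_(i < m) msize (h j i)).
have aQ j : (msize (Q j) <= a.+1)%N.
  apply: leqW; apply: leq_trans (@leq_bigmax J _ j); exact: leq_maxl.
have ah j i : (i < m)%N -> (msize (h' j i) <= a.+1)%N.
  move=> im; rewrite /h' insubT; apply: leqW; apply: leq_trans (@leq_bigmax J _ j).
  by apply: leq_trans (leq_maxr _ _); exact: (leq_bigmax (Ordinal im)).
(* There are at most |J| b^D coefficients and b <= (N+1)(a m + 1), so this [N] bounds their number
   by N (N+1)^D < (N+1)^(D+1) <= (N+1)^m. *)
pose N := (#|J| * (a * m + 1) ^ D)%N.
pose b := (N * a * m).+1.
pose T := {j : J & bmultinom (E j) b}.
pose W (e : exponents N m) (x : T) :=
  (monomial (Q (tag x)) (h' (tag x)) e)@_(tagged x).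
have [|c [e0 ce0] cW] := @wide_kernel _ (exponents N m) T W.
  rewrite card_exponents card_tagged sumnE big_map big_enum /=.
  apply: (@leq_ltn_trans (#|J| * (N.+1 * (a * m + 1)) ^ D)).
    rewrite -sum_nat_const leq_sum // => j _.
    apply: leq_trans (card_bmultinom_leq _ _) _.
    apply: (@leq_trans (b ^ D)); first exact: leq_pexp2l.
    have [->|D0] := posnP D; first by rewrite !expn0.
    by rewrite leq_exp2r // /b; nia.
  rewrite expnMn mulnCA -/N mulnC.
  apply: (@leq_trans (N.+1 ^ D.+1)); last exact: leq_pexp2l.
  by rewrite expnS ltn_pmul2r ?expn_gt0.
have : C 0%N (\sum_e c e *: monomial 1 f e).
  apply: CS => _ /SP[j [t ->]].
  have q0 : q j t != 0 by case: (phiP j).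
  (* Coefficients in degree < b vanish by the choice of [c], the others by the degree bound. *)
  have cQ0 : \sum_e c e *: monomial (Q j) (h' j) e = 0.
    apply/mpolyP => mm; rewrite mcoeff0 linear_sum /=.
    under eq_bigr do rewrite mcoeffZ.
    have [mb|mb] := ltnP (mdeg mm) b.
      by have := cW (Tagged (fun j => bmultinom (E j) b) (BMultinom mb)).
    rewrite big1 // => e _; rewrite memN_msupp_eq0 ?mulr0 //.
    apply: msize_mdeg_ge; apply: leq_trans mb.
    exact: (msize_monomial e (@ah j) (aQ j)).
  apply/eqP; rewrite linear_sum /=.
  move: cQ0 => /(congr1 (meval t)); rewrite meval0 linear_sum /= => cQ0.
  (* Multiplying by the nonzero (q^r)^(N m) turns the monomials in the [f i] into the homogenised
     ones. *)
  rewrite -(mulrI_eq0 _ (mulfI (expf_neq0 (N * m) (expf_neq0 r q0)))).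
  apply/eqP; rewrite -[RHS]cQ0 big_distrr /=; apply: eq_bigr => e _.
  rewrite !mevalZ mulrCA; congr (_ * _).
  rewrite !monomial_rmorph -monomial_scale rmorph1 mulr1 QP.
  apply: monomial_eq => i im; by rewrite /h' insubT /= -hP -QP.
move/prime_chain_independent => c0; move: ce0; rewrite c0 ?eqxx //.
by move=> i im; case: (Cchain i im).
Qed.

End PrimeChains.

(** * Adapted bases, orthogonal projections, staircase matrices *)

Section FlagBasis.
Variables (F : fieldType) (n : nat).

Definition supported (r : nat) (y : 'rV[F]_n) :=
  forall c : 'I_n, (r <= c)%N -> y 0 c = 0.

Lemma supportedP r y : supported r y <-> (y <= (pid_mx r : 'M[F]_n))%MS.
Proof.
split=> [ysupp|/submxP[z ->] c rc].
  have -> : y = y *m pid_mx r.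
    apply/rowP => c; rewrite mxE (bigD1 c) //= big1 => [|c' c'c].
      rewrite mxE eqxx addr0; case: ltnP => rc; first by rewrite mulr1.
      by rewrite mulr0 ysupp.
    by rewrite mxE val_eqE (negPf c'c) mulr0.
  exact: submxMl.
rewrite mxE big1 // => c' _; rewrite mxE.
by case: eqP => [->|_]; rewrite ?(ltnNge c) ?rc mulr0.
Qed.

Lemma subspace_extension (U V : 'M[F]_n) : (U <= V)%MS ->
  exists g : nat -> 'rV[F]_n,
    (V :=: U + \sum_(0 <= i < \rank V - \rank U) <<g i>>)%MS.
Proof.
move=> UV; pose B := row_base (V :\: U)%MS.
exists (fun i => if insub i is Some i' then row i' B else 0).
have -> : (\rank V - \rank U = \rank (V :\: U))%N.
  by rewrite -(mxrank_cap_compl V U) (capmx_idPr UV) addKn.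
rewrite big_mkord; apply/eqmxP/andP; split.
  rewrite -(addsmx_diff_cap_eq V U) addsmxC addsmxS ?capmxSr //.
  rewrite -(eq_row_base (V :\: U)%MS).
  apply/row_subP => i; apply: (sumsmx_sup i) => //.
  by rewrite genmxE valK.
rewrite addsmx_sub UV; apply/sumsmx_subP => i _.
rewrite genmxE valK; apply: submx_trans (row_sub _ _) _.
by rewrite eq_row_base diffmxSl.
Qed.

(** A single sequence serves the whole flag: at each step, vectors spanning a complement of [U m] in
    the next member are appended behind the first [\rank (U m)] terms. *)
Lemma flag_spanning_seq (U : nat -> 'M[F]_n) m :
  (forall j, (j < m)%N -> (U j <= U j.+1)%MS) ->
  exists g : nat -> 'rV[F]_n, forall j, (j <= m)%N ->
    (U j :=: \sum_(0 <= i < \rank (U j)) <<g i>>)%MS.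
Proof.
elim: m => [_|m IHm Um].
  have [g gP] := subspace_extension (sub0mx n (U 0%N)).
  exists g => j; rewrite leqn0 => /eqP->.
  by move: gP; rewrite mxrank0 subn0 => gP; apply: eqmx_trans gP _; apply: adds0mx.
have [|g gP] := IHm; first by move=> j jm; apply: Um; apply: ltnW.
have [h hP] := subspace_extension (Um m (ltnSn m)).
have rj j : (j <= m)%N -> (\rank (U j) <= \rank (U m))%N.
  move=> jm; elim: m jm Um {IHm gP hP} => [|m IHm]; first by rewrite leqn0 => /eqP->.
  rewrite leq_eqVlt => /orP[/eqP-> //|jm Um].
  apply: leq_trans (mxrankS (Um m _)) => //.
  by apply: IHm => // i im; apply: Um; apply: leqW.
exists (fun i => if (i < \rank (U m))%N then g i else h (i - \rank (U m))%N).
have sumg j : (j <= m)%N ->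
    (\sum_(0 <= i < \rank (U j))
       <<if (i < \rank (U m))%N then g i else h (i - \rank (U m))%N>> =
     \sum_(0 <= i < \rank (U j)) <<g i>>)%MS.
  move=> jm; apply: eq_big_nat => i /andP[_ ij].
  by rewrite (leq_trans ij (rj _ jm)).
move=> j; rewrite leq_eqVlt => /orP[/eqP->|jm]; last by rewrite sumg //; apply: gP.
have rm : (\rank (U m) <= \rank (U m.+1))%N by rewrite mxrankS // Um.
rewrite (big_cat_nat _ rm) //= sumg //.
have -> : (\sum_(\rank (U m) <= i < \rank (U m.+1))
    <<if (i < \rank (U m))%N then g i else h (i - \rank (U m))%N>> =
    \sum_(0 <= i < \rank (U m.+1) - \rank (U m)) <<h i>>)%MS.
  rewrite -[X in \big[_/_]_(X <= _ < _) _]add0n big_addn.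
  by apply: eq_big_nat => i _; rewrite ltnNge leq_addl /= addnK.
by apply: eqmx_trans hP _; apply: adds_eqmx; first exact: gP.
Qed.

Lemma flag_adapted_basis (U : nat -> 'M[F]_n) m :
  (forall j, (j < m)%N -> (U j <= U j.+1)%MS) ->
  exists2 G : 'M[F]_n, G \in unitmx & forall j, (j <= m)%N ->
    forall y, (y *m G <= U j)%MS <-> supported (\rank (U j)) y.
Proof.
move=> Um; pose V j := if (j <= m)%N then U j else 1%:M.
have [j|g gP] := @flag_spanning_seq V m.+1.
  by rewrite ltnS /V => -> ; case: ltnP => [/Um|_] //; apply: submx1.
pose G : 'M[F]_n := \matrix_i g i.
have VE j : (j <= m)%N -> V j = U j by rewrite /V => ->.
have spanG r : (r <= n)%N ->
    (\sum_(0 <= i < r) <<g i>> :=: (pid_mx r : 'M_n) *m G)%MS.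
  move=> rn; apply/eqmxP/andP; split.
    rewrite big_mkord; apply/sumsmx_subP => i _; rewrite genmxE.
    have -> : g i = row (widen_ord rn i) G by apply/rowP => c; rewrite !mxE.
    rewrite rowE submxMr //; apply/supportedP => c rc.
    by rewrite mxE eqxx; case: eqP rc => // ->; rewrite leqNgt /= ltn_ord.
  apply/row_subP => i; rewrite row_mul; case: (ltnP i r) => ir; last first.
    suff -> : row i (pid_mx r : 'M[F]_n) = 0 by rewrite mul0mx sub0mx.
    by apply/rowP => c; rewrite !mxE ltnNge ir andbF.
  rewrite big_mkord; apply: (sumsmx_sup (Ordinal ir)) => //=.
  rewrite genmxE.
  suff -> : row i (pid_mx r : 'M[F]_n) = delta_mx 0 i.
    by rewrite -rowE (_ : row i G = g i) //; apply/rowP => c; rewrite !mxE.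
  by apply/rowP => c; rewrite !mxE eqxx ir andbT eq_sym.
have Gunit : G \in unitmx.
  rewrite -row_full_unit -sub1mx.
  have := gP m.+1 (leqnn _); rewrite /V ltnn mxrank1 => E.
  rewrite E (spanG n (leqnn n)) pid_mx_1 mul1mx submx_refl //.
exists G => // j jm y.
have := gP j (leqW jm); rewrite VE // => E.
rewrite E spanG ?rank_leq_row // submxMfree ?row_free_unit //.
by split=> /supportedP.
Qed.

End FlagBasis.

Section OrthogonalProjection.
Variables (R : realType) (m n : nat).
Implicit Type M : 'M[R]_(m, n).

Lemma mulmx_tr_eq0 (v : 'rV[R]_n) : v *m v^T = 0 -> v = 0.
Proof.
move/matrixP/(_ 0 0); rewrite !mxE => /eqP.
rewrite psumr_eq0 => [/allP v0|i _]; last by rewrite mxE -expr2 sqr_ge0.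
apply/rowP => i; have := v0 i; rewrite mem_index_enum !mxE -expr2 sqrf_eq0.
by move=> /(_ isT)/eqP.
Qed.

(** If v M M^T = 0 then v M has zero norm; over the reals this forces v M = 0. *)
Lemma gram_unit M : row_free M -> M *m M^T \in unitmx.
Proof.
move=> Mfree; rewrite -row_free_unit -kermx_eq0.
apply/rowV0P => v /sub_kermxP vM.
apply: (row_free_inj Mfree); rewrite mul0mx; apply: mulmx_tr_eq0.
by rewrite trmx_mul !mulmxA -(mulmxA v) vM mul0mx.
Qed.

Definition orthoproj M : 'M[R]_n := M^T *m invmx (M *m M^T) *m M.

Lemma orthoproj_tr M : (orthoproj M)^T = orthoproj M.
Proof. by rewrite /orthoproj !trmx_mul trmx_inv trmx_mul !trmxK mulmxA. Qed.

Lemma mul_orthoproj M : row_free M -> M *m orthoproj M = M.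
Proof.
by move=> /gram_unit Mu; rewrite /orthoproj !mulmxA mulmxV // mul1mx.
Qed.

Lemma orthoproj_idem M : row_free M -> orthoproj M *m orthoproj M = orthoproj M.
Proof. by move=> Mf; rewrite {1}/orthoproj -mulmxA mul_orthoproj. Qed.

Lemma eqmx_orthoproj M : row_free M -> (orthoproj M :=: M)%MS.
Proof.
move=> Mf; apply/eqmxP; rewrite submxMl /=.
by rewrite -{1}(mul_orthoproj Mf) submxMl.
Qed.

Lemma rank_orthoproj M : row_free M -> \rank (orthoproj M) = m.
Proof. by move=> Mf; rewrite eqmx_orthoproj //; apply/eqP. Qed.

(** The adjugate replaces the inverse, so the Gram determinant is the only denominator of the
    projection. *)
Lemma orthoproj_det M : row_free M ->
  \det (M *m M^T) *: orthoproj M = M^T *m \adj (M *m M^T) *m M.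
Proof.
move=> /gram_unit Mu; rewrite /orthoproj /invmx Mu -scalemxAr -scalemxAl scalerA.
by rewrite divrr ?scale1r // -unitmxE.
Qed.

(** Each projection fixes the common row space, so P Q = P and Q P = Q; transposing one identity
    gives the other product. *)
Lemma projection_unique (P Q : 'M[R]_n) :
  P^T = P -> Q^T = Q -> P *m P = P -> Q *m Q = Q -> (P :=: Q)%MS -> P = Q.
Proof.
move=> Pt Qt PP QQ PQ.
have /submxP[A PA] : (P <= Q)%MS by rewrite PQ.
have /submxP[B QB] : (Q <= P)%MS by rewrite PQ.
have PQP : P *m Q = P by rewrite PA -mulmxA QQ.
have QPQ : Q *m P = Q by rewrite QB -mulmxA PP.
by rewrite -QPQ -[in RHS]Qt -[in RHS]Pt -trmx_mul PQP.
Qed.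

End OrthogonalProjection.

Section Staircase.
Variables (F : fieldType) (k n : nat) (d : 'I_k -> nat).
Implicit Types (pi : 'I_k -> 'I_n) (T : 'M[F]_(k, n)).

(** The pivot columns may come in any order: zeros are imposed by the order of the rows, and [pi]
    need not increase. *)
Definition staircase pi T :=
  [/\ forall i, T i (pi i) = 1,
      forall i i' : 'I_k, (i' < i)%N -> T i (pi i') = 0 &
      forall i, supported (d i) (row i T)].

Lemma staircase_pivot_lt pi T i : staircase pi T -> (pi i < d i)%N.
Proof.
case=> T1 _ Ts; rewrite ltnNge; apply/negP => /(Ts i); rewrite mxE T1 => /eqP.
by rewrite oner_eq0.
Qed.

Lemma staircase_pivot_inj pi T : staircase pi T -> injective pi.
Proof.
case=> T1 T0 _ i j pij; apply: val_inj; case: (ltngtP i j) => // lt.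
  by have /eqP := T0 _ _ lt; rewrite pij T1 oner_eq0.
by have /eqP := T0 _ _ lt; rewrite -pij T1 oner_eq0.
Qed.

(** The pivot columns form a triangular block with unit diagonal. *)
Lemma staircase_row_free pi T : staircase pi T -> row_free T.
Proof.
case=> T1 T0 _.
have Tu : mxsub id pi T \in unitmx.
  rewrite -unitmx_tr unitmxE det_trig; last first.
    by apply/is_trig_mxP => i j ij; rewrite !mxE T0.
  by rewrite big1 ?unitr1 // => i _; rewrite !mxE T1.
rewrite -kermx_eq0; apply/rowV0P => v /sub_kermxP vT.
rewrite -[v]mulmx1 -(mulmxV Tu) mulmxA (_ : v *m _ = 0) ?mul0mx //.
apply/rowP => j; move/rowP/(_ (pi j)): vT; rewrite !mxE => E.
rewrite -[RHS]E; apply: eq_bigr => i _; rewrite !mxE //.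
Qed.

End Staircase.

(* Row i is picked in V i with a zero in the i pivot columns already chosen,
   which is possible because V i has dimension > i. *)
Lemma staircase_exists (F : fieldType) k n (d : 'I_k -> nat) (V : 'I_k -> 'M[F]_n) :
  (forall i : 'I_k, (i < \rank (V i))%N) ->
  (forall i y, (y <= V i)%MS -> supported (d i) y) ->
  exists (pi : 'I_k -> 'I_n) (T : 'M[F]_(k, n)),
    staircase d pi T /\ forall i, (row i T <= V i)%MS.
Proof.
move=> Vrank Vsupp.
have pick (i : 'I_k) (p : 'I_k -> 'I_n) : exists cw : 'I_n * 'rV[F]_n,
    [/\ (cw.2 <= V i)%MS, cw.2 0 cw.1 = 1 &
      forall i' : 'I_k, (i' < i)%N -> cw.2 0 (p i') = 0].
  (* Multiplication by [sel] reads the entries at the i earlier pivots; its kernel meets [V i] in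
     dimension at least [\rank (V i)] - i > 0. *)
  pose sel : 'M[F]_(n, i) :=
    \matrix_(c, j) (c == p (widen_ord (ltnW (ltn_ord i)) j))%:R.
  have : (V i :&: kermx sel)%MS != 0.
    rewrite -mxrank_eq0 -lt0n -(ltn_add2l (\rank (V i *m sel))) mxrank_mul_ker.
    by rewrite addn0; apply: leq_ltn_trans (Vrank i); apply: rank_leq_col.
  case/rowV0Pn => w; rewrite sub_capmx => /andP[wV /sub_kermxP w0].
  case/rV0Pn => c wc; exists (c, (w 0 c)^-1 *: w) => /=; split.
  - exact: scalemx_sub.
  - by rewrite mxE mulVf.
  - move=> i' ii'; rewrite mxE; move/rowP/(_ (Ordinal ii')): w0; rewrite !mxE.
    rewrite (bigD1 (p i')) //= big1 => [|c' /negPf c'p].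
      rewrite mxE (_ : widen_ord _ _ = i') ?eqxx; last exact: val_inj.
      by rewrite mulr1 addr0 => ->; rewrite mulr0.
    by rewrite mxE (_ : widen_ord _ _ = i') ?c'p ?mulr0 //; apply: val_inj.
suff [pi [w wP]] : exists (pi : 'I_k -> 'I_n) (w : 'I_k -> 'rV[F]_n), forall i : 'I_k,
    [/\ (w i <= V i)%MS, w i 0 (pi i) = 1 &
      forall i' : 'I_k, (i' < i)%N -> w i 0 (pi i') = 0].
  exists pi, (\matrix_i w i); split; last first.
    by move=> i; rewrite rowK; case: (wP i).
  split=> [i|i i' ii'|i]; rewrite ?mxE; try by case: (wP i) => // _ _; apply.
  by rewrite rowK; apply: Vsupp; case: (wP i).
suff H m : (m <= k)%N -> exists (pi : 'I_k -> 'I_n) (w : 'I_k -> 'rV[F]_n),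
    forall i : 'I_k, (i < m)%N ->
    [/\ (w i <= V i)%MS, w i 0 (pi i) = 1 &
      forall i' : 'I_k, (i' < i)%N -> w i 0 (pi i') = 0].
  have [pi [w wP]] := H k (leqnn k).
  by exists pi, w => i; apply: wP.
elim: m => [_|m IHm mk].
  (* Some function must exist to start from; a nonzero [V i] supplies a column. *)
  have [pi] : exists pi : 'I_k -> 'I_n, True; last by exists pi, (fun=> 0).
  suff [cw _] : exists cw : 'I_k -> 'I_n, forall i : 'I_k, True by exists cw.
  apply: (@fin_all_exists _ (fun=> 'I_n) (fun _ _ => True)) => i.
  have /matrix0Pn[_ [c _]] : V i != 0; last by exists c.
  by rewrite -mxrank_eq0 -lt0n (leq_ltn_trans _ (Vrank i)).
have [pi [w wP]] := IHm (ltnW mk).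
pose i0 := Ordinal mk.
have [[c u] /= [uV u1 u0]] := pick i0 pi.
exists (fun i => if i == i0 then c else pi i), (fun i => if i == i0 then u else w i).
move=> i; rewrite ltnS leq_eqVlt -[_ == _]/(i == i0 :> 'I_k).
case: eqP => [-> _|_ /= im].
  split=> // i' ii'; case: eqP ii' => [->|_ ii']; first by rewrite ltnn.
  exact: u0.
have [wV w1 w0] := wP _ im; split=> // i' ii'.
case: eqP ii' => [->|_ ii']; last exact: w0.
by move=> /(ltn_trans im); rewrite ltnn.
Qed.

(** * Charts of the affine Schubert variety *)

Lemma card_ord_ltn n m : (m <= n)%N -> #|[set c : 'I_n | (c < m)%N]| = m.
Proof.
move=> mn; rewrite -sum1_card; under eq_bigl do rewrite inE.
by rewrite (big_ord_narrow mn) sum1_card card_ord.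
Qed.

Section FreePositions.
Variables (k n : nat) (d : 'I_k.+1 -> nat).
Implicit Type pi : 'I_k.+1 -> 'I_n.

(* Row ord0 holds the translation vector, row lift ord0 i the i-th row of the
   staircase matrix. *)
Definition free_pos pi (o : 'I_k.+2 * 'I_n) : bool :=
  if unlift ord0 o.1 is Some i
  then (o.2 < d i)%N && [forall i' : 'I_k.+1, (i' <= i)%N ==> (o.2 != pi i')]
  else (o.2 < d ord0)%N && (o.2 != pi ord0).

Definition nfree pi := #|[set o | free_pos pi o]|.

Definition valid_pivots pi := injectiveb pi && [forall i, (pi i < d i)%N].

(** Row i has d_i columns, from which the i + 1 distinct pivots of rows up to i are removed; they
    all lie there since [d] is monotone. The translation row loses the first pivot only. Hence all
    charts have the same number of parameters. *)
Lemma nfreeE pi : {homo d : i j / (i <= j)%N} -> (forall i, d i <= n)%N ->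
  valid_pivots pi ->
  nfree pi = (\sum_(i < k.+1) (d i - i.+1) + (d ord0 - 1))%N.
Proof.
move=> dmono dn /andP[/injectiveP pinj /forallP pid].
rewrite /nfree -sum1_card big_mkcond /=.
under eq_bigr do rewrite inE.
rewrite -(pair_bigA _ (fun o c => if free_pos pi (o, c) then 1 else 0)%N) /=.
rewrite big_ord_recl addnC; congr (_ + _)%N.
  apply: eq_bigr => i _; rewrite -big_mkcond /= /free_pos /= liftK.
  pose L := [set c : 'I_n | (c < d i)%N].
  pose I := [set i' : 'I_k.+1 | (i' <= i)%N].
  have IL : pi @: I \subset L.
    apply/subsetP => _ /imsetP[i' i'I ->]; rewrite inE in i'I; rewrite inE.
    exact: leq_trans (pid i') (dmono _ _ i'I).
  have -> : (d i - i.+1 = #|L :\: pi @: I|)%N.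
    rewrite cardsDS // card_ord_ltn // card_imset // /I.
    congr (_ - _)%N; exact/esym/(card_ord_ltn (ltn_ord i)).
  rewrite -sum1_card; apply: eq_bigl => c; rewrite !inE andbC; congr (_ && _).
  apply/forallP/negP => [H /imsetP[i' i'I cE]|H i'].
    by have := H i'; rewrite inE in i'I; rewrite (i'I : (i' <= i)%N) cE eqxx.
  apply/implyP => i'i; apply: contra_notN H => /eqP ->.
  by apply/imsetP; exists i'; rewrite ?inE.
rewrite -big_mkcond /= /free_pos /= unlift_none.
have -> : (d ord0 - 1 = #|[set c : 'I_n | (c < d ord0)%N] :\ pi ord0|)%N.
  have := cardsD1 (pi ord0) [set c : 'I_n | (c < d ord0)%N].
  by rewrite card_ord_ltn // inE pid add1n => dE; rewrite [LHS]subn1 [X in X.-1]dE.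
by rewrite -sum1_card; apply: eq_bigl => c; rewrite !inE andbC.
Qed.

End FreePositions.

Section Chart.
Variables (R : realType) (k n : nat) (d : 'I_k.+1 -> nat).
Variables (G : 'M[R]_n) (b : 'rV[R]_n).
Hypothesis Gunit : G \in unitmx.
Implicit Type pi : 'I_k.+1 -> 'I_n.

Section Entries.
Variable pi : 'I_k.+1 -> 'I_n.
Local Notation params := ('I_(nfree d pi) -> R).
Implicit Type t : params.

(** The parameter sitting at position [o], or 0 if there is none; the sum makes linearity in [t]
    apparent. *)
Definition chart_entry t o : R := \sum_a t a *+ (enum_val a == o).

Lemma chart_entry_val t a : chart_entry t (enum_val a) = t a.
Proof.
rewrite /chart_entry (bigD1 a) //= eqxx big1 ?addr0 // => a' a'a.
by rewrite (inj_eq enum_val_inj) (negPf a'a).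
Qed.

Lemma chart_entry0 t o : ~~ free_pos d pi o -> chart_entry t o = 0.
Proof.
move=> oF; rewrite /chart_entry big1 // => a _; case: eqP => // ao.
by have := enum_valP a; rewrite inE ao (negPf oF).
Qed.

Lemma chart_entry_onto (f : 'I_k.+2 * 'I_n -> R) :
  (forall o, ~~ free_pos d pi o -> f o = 0) -> exists t, chart_entry t =1 f.
Proof.
move=> f0; exists (fun a => f (enum_val a)) => o.
have [oF|oF] := boolP (free_pos d pi o); last by rewrite chart_entry0 ?f0.
have oI : o \in [set o | free_pos d pi o] by rewrite inE.
by rewrite -(enum_rankK_in oI oI) chart_entry_val.
Qed.

Lemma polyfun_chart_entry o : polyfun (chart_entry ^~ o).
Proof.
apply: polyfun_sum => a _; case: eqP => _; first exact: polyfunX.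
exact: polyfunC.
Qed.

Definition chart_mx t : 'M[R]_(k.+1, n) :=
  \matrix_(i, c) ((c == pi i)%:R + chart_entry t (lift ord0 i, c)).

Definition chart_shift t : 'rV[R]_n := \row_c chart_entry t (ord0, c).

Definition chart_gram t := (chart_mx t *m G) *m (chart_mx t *m G)^T.

Definition chart_proj t := orthoproj (chart_mx t *m G).

Definition chart_foot t := (b + chart_shift t *m G) *m (1%:M - chart_proj t).

Definition chart t := graff_coords (chart_proj t) (chart_foot t).

Lemma chart_staircase t : valid_pivots d pi -> staircase d pi (chart_mx t).
Proof.
move=> /andP[/injectiveP pinj /forallP pid]; split=> [i|i i' ii'|i c dc].
- rewrite mxE eqxx chart_entry0 ?addr0 // /free_pos /= liftK.
  rewrite negb_and negb_forall; apply/orP; right; apply/existsP.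
  by exists i; rewrite leqnn eqxx.
- rewrite mxE chart_entry0.
    by rewrite (inj_eq pinj) -val_eqE (ltn_eqF ii') addr0.
  rewrite /free_pos /= liftK negb_and negb_forall; apply/orP; right.
  by apply/existsP; exists i'; rewrite (ltnW ii') eqxx.
- rewrite !mxE chart_entry0 /free_pos /= ?liftK ?ltnNge ?dc // addr0.
  by case: eqP dc => // ->; rewrite leqNgt pid.
Qed.

Lemma chart_shift_supported t : supported (d ord0) (chart_shift t).
Proof.
by move=> c dc; rewrite mxE chart_entry0 // /free_pos /= unlift_none ltnNge dc.
Qed.

Lemma chart_shift_pivot t : chart_shift t 0 (pi ord0) = 0.
Proof. by rewrite mxE chart_entry0 // /free_pos /= unlift_none eqxx andbF. Qed.

Lemma chart_row_free t : valid_pivots d pi -> row_free (chart_mx t *m G).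
Proof.
move=> /(chart_staircase t)/staircase_row_free Tf.
by rewrite /row_free mxrankMfree // row_free_unit.
Qed.

(** The Gram determinant clears both the projection and the foot, and never vanishes because the
    rows stay independent. *)
Lemma ratmap_chart : valid_pivots d pi ->
  ratmap chart (fun t => \det (chart_gram t)).
Proof.
move=> piv.
have Tp : polymx chart_mx.
  move=> i c; apply: (@polyfun_ext _ _ _
    (fun t => (c == pi i)%:R + chart_entry t (lift ord0 i, c))) => [t|].
    by rewrite mxE.
  by apply: polyfunD; [exact: polyfunC | exact: polyfun_chart_entry].
have sp : polymx chart_shift.
  move=> i c; apply: (@polyfun_ext _ _ _ (chart_entry ^~ (ord0, c))) => [t|].
    by rewrite mxE.
  exact: polyfun_chart_entry.
have Mp : polymx (fun t => chart_mx t *m G).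
  by apply: polymx_mul => //; apply: polymxC.
have Gp : polymx chart_gram by apply: polymx_mul => //; apply: polymx_tr.
have Pp : polymx (fun t => \det (chart_gram t) *: chart_proj t).
  apply: (@polymx_ext _ _ _ _ _ (fun t => (chart_mx t *m G)^T *m
     \adj (chart_gram t) *m (chart_mx t *m G))) => [t|].
    by apply: orthoproj_det; apply: chart_row_free.
  apply: polymx_mul => //; apply: polymx_mul; first exact: polymx_tr.
  exact: polymx_adj.
have vp : polymx (fun t => \det (chart_gram t) *: chart_foot t).
  apply: (@polymx_ext _ _ _ _ _ (fun t => (b + chart_shift t *m G) *m
     (\det (chart_gram t) *: 1%:M - \det (chart_gram t) *: chart_proj t))) => [t|].
    by rewrite -scalerBr -scalemxAr.
  apply: polymx_mul.
    apply: polymxD; first exact: polymxC.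
    by apply: polymx_mul => //; apply: polymxC.
  apply: polymxB => //; apply: polymxZ; last exact: polymxC.
  exact: polyfun_det.
split=> [|t|i]; first exact: polyfun_det.
  by rewrite -unitfE -unitmxE gram_unit // chart_row_free.
have [{}i ->|j ->] := split_ordP i.
  case/mxvec_indexP: i => a c; apply: polyfun_ext (Pp a c) => t.
  by rewrite /chart /graff_coords row_mxEl mxvecE [RHS]mxE.
by apply: polyfun_ext (vp 0 j) => t; rewrite /chart /graff_coords row_mxEr [RHS]mxE.
Qed.

Definition proj_coord (x : 'I_(n * n + n) -> R) : 'M[R]_n :=
  \matrix_(i, j) x (lshift n (mxvec_index i j)).

Definition foot_coord (x : 'I_(n * n + n) -> R) : 'rV[R]_n :=
  \row_j x (rshift (n * n) j).

Lemma proj_coord_graff (P : 'M[R]_n) v : proj_coord (graff_coords P v) = P.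
Proof. by apply/matrixP => i j; rewrite mxE /graff_coords row_mxEl mxvecE. Qed.

Lemma foot_coord_graff (P : 'M[R]_n) v : foot_coord (graff_coords P v) = v.
Proof. by apply/rowP => j; rewrite mxE /graff_coords row_mxEr. Qed.

(* With pivots as far right as possible the staircase matrix T is fully
   reduced, so in the basis G the pivot rows of the projection are C T and
   its pivot block is C, where C is the inverse Gram matrix; hence
   [\adj C *m (C *m T) = \det C *: T] recovers T up to a nonzero factor. *)
Lemma chart_inverse :
  {homo d : i j / (i < j)%N} -> (forall i, (pi i).+1 = d i) ->
  exists (u : 'I_(nfree d pi) -> {mpoly R[n * n + n]}) w,
    (forall t : params, w t != 0) /\
    forall a t, (u a).@[chart t] = w t * t a.
Proof.
move=> dmono pid.
have piv : valid_pivots d pi.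
  apply/andP; split; last by apply/forallP => i; rewrite -pid.
  apply/injectiveP => i j pij; apply: val_inj.
  by case: (ltngtP i j) => // /dmono; rewrite -!pid pij ltnn.
pose H := invmx G.
pose P' x := H^T *m proj_coord x *m H.
pose K x := mxsub pi pi (P' x).
pose Y x := (foot_coord x - b) *m H.
pose UT x := \adj (K x) *m rowsub pi (P' x).
(* In the basis [G] the foot relative to [b] is s - B T with s zero at the pivots; its pivot entries
   give -B, and adding B T back recovers s. *)
pose Us x := \det (K x) *: Y x - colsub pi (Y x) *m UT x.
pose U (o : 'I_k.+2 * 'I_n) x :=
  if unlift ord0 o.1 is Some i then UT x i o.2 else Us x 0 o.2.
have Pp : polymx P'.
  apply: polymx_mul; last exact: polymxC.
  apply: polymx_mul; first exact: polymxC.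
  move=> i j; apply: polyfun_ext (polyfunX _ (lshift n (mxvec_index i j))) => x.
  by rewrite mxE.
have Kp : polymx K by apply: polymx_sub.
have Yp : polymx Y.
  apply: polymx_mul; last exact: polymxC.
  apply: polymxB; last exact: polymxC.
  move=> i j; apply: polyfun_ext (polyfunX _ (rshift (n * n) j)) => x.
  by rewrite mxE.
have UTp : polymx UT.
  by apply: polymx_mul; [apply: polymx_adj | apply: polymx_sub].
have Usp : polymx Us.
  apply: polymxB; first by apply: polymxZ => //; apply: polyfun_det.
  by apply: polymx_mul => //; apply: polymx_sub.
have [u uP] : exists u : 'I_(nfree d pi) -> {mpoly R[n * n + n]},
    forall a x, U (enum_val a) x = (u a).@[x].
  apply: (@fin_all_exists _ (fun=> {mpoly R[n * n + n]})
    (fun a p => forall x, U (enum_val a) x = p.@[x])) => a.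
  by rewrite /U; case: unlift => [i|]; [apply: UTp | apply: Usp].
exists u, (fun t => \det (invmx (chart_gram t))); split=> [t|a t].
  by rewrite -unitfE -unitmxE unitmx_inv gram_unit // chart_row_free.
have [T1 T0 Ts] := chart_staircase t piv.
(* For i < j the pivot of row j is column d_j - 1 >= d_i, outside the support of row i. *)
have colT : colsub pi (chart_mx t) = 1%:M.
  apply/matrixP => i j; rewrite [LHS]mxE [RHS]mxE.
  case: (ltngtP i j) => [ij|ij|/val_inj->]; last by rewrite eqxx T1.
    have := Ts i (pi j); rewrite mxE => ->; first by rewrite -val_eqE ltn_eqF.
    by rewrite -ltnS pid dmono.
  by rewrite T0 // -val_eqE gtn_eqF.
have MH : chart_mx t *m G *m H = chart_mx t by rewrite mulmxK.
have PH : P' (chart t) = (chart_mx t)^T *m invmx (chart_gram t) *m chart_mx t.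
  rewrite /P' proj_coord_graff /chart_proj /orthoproj -/(chart_gram t).
  by rewrite !mulmxA -trmx_mul MH -!mulmxA (mulmxA _ G) MH.
have pivrows : rowsub pi (P' (chart t)) = invmx (chart_gram t) *m chart_mx t.
  by rewrite PH -mulmxA -mul_rowsub_mx -trmx_mxsub colT trmx1 mul1mx.
have KE : K (chart t) = invmx (chart_gram t).
  by rewrite /K mxsubcr pivrows -mulmx_colsub colT mulmx1.
have UTE : UT (chart t) = \det (invmx (chart_gram t)) *: chart_mx t.
  by rewrite /UT KE pivrows mulmxA mul_adj_mx mul_scalar_mx.
have UsE : Us (chart t) = \det (invmx (chart_gram t)) *: chart_shift t.
  pose B := (b + chart_shift t *m G) *m (chart_mx t *m G)^T *m
              invmx (chart_gram t).
  have YE : Y (chart t) = chart_shift t - B *m chart_mx t.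
    rewrite /Y foot_coord_graff /chart_foot mulmxBr mulmx1 addrAC (addrC b) addrK.
    rewrite mulmxBl mulmxK //; congr (_ - _).
    rewrite /chart_proj /orthoproj -/(chart_gram t) /B -!mulmxA mulmxV //.
    by rewrite mulmx1 addrC.
  have Ypi : colsub pi (Y (chart t)) = - B.
    rewrite YE linearB /= -mulmx_colsub colT mulmx1.
    rewrite (_ : colsub pi (chart_shift t) = 0) ?sub0r //.
    apply/rowP => i; rewrite [LHS]mxE [RHS]mxE.
    have [->|i0] := eqVneq i ord0; first exact: chart_shift_pivot.
    by rewrite chart_shift_supported // -ltnS pid dmono // lt0n.
  rewrite /Us KE UTE Ypi YE mulNmx opprK -scalemxAr scalerBr.
  by rewrite subrK.
rewrite -uP /U.
have := enum_valP a; rewrite inE -[in RHS]chart_entry_val /free_pos.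
case: (enum_val a) => o c /=; case: unliftP => [i ->|->].
  move=> /andP[_ /forallP/(_ i)]; rewrite leqnn /= => /negPf cpi.
  by rewrite UTE !mxE cpi add0r.
by move=> _; rewrite UsE !mxE.
Qed.

End Entries.

Section SchubertVariety.
Variables (A : nat -> 'M[R]_n) (c : nat -> 'rV[R]_n).
Hypothesis dmono : {homo d : i j / (i <= j)%N}.
Hypothesis AG : forall (i : 'I_k.+1) y,
  (y *m G <= A i.+1)%MS <-> supported (d i) y.
Hypothesis bc : b = c 1%N.
Hypothesis flag : forall (i : 'I_k.+1) x,
  affsp (A 1%N) (c 1%N) x -> affsp (A i.+1) (c i.+1) x.

(** The point [b + chart_shift t *m G] lies on the plane and in the first flag member, so it serves
    for every j; the first j rows of the staircase matrix give j independent common directions. *)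
Lemma chart_in_schubert pi (t : 'I_(nfree d pi) -> R) :
  valid_pivots d pi -> affine_schubert k.+1 A c (chart t).
Proof.
move=> piv; have Mf := chart_row_free t piv.
have [T1 T0 Ts] := chart_staircase t piv.
exists (chart_proj t), (chart_foot t); split=> //.
  split; [exact: orthoproj_tr | exact: orthoproj_idem | exact: rank_orthoproj |].
  by rewrite /chart_foot -mulmxA mulmxBl mul1mx orthoproj_idem // subrr mulmx0.
case=> // j /= jk; pose i := Ordinal jk.
exists (b + chart_shift t *m G); split.
- rewrite /affsp /chart_foot mulmxBr mulmx1 opprB addrC subrK.
  exact: submxMl.
- apply: (flag i); rewrite /affsp -bc addrC addKr.
  exact/(AG ord0)/chart_shift_supported.
- apply: (@leq_trans (\rank ((pid_mx j.+1 : 'M[R]_k.+1) *m (chart_mx t *m G)))).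
    by rewrite mxrankMfree // rank_pid_mx.
  apply: mxrankS; rewrite sub_capmx; apply/andP; split.
    by rewrite eqmx_orthoproj // submxMl.
  apply/row_subP => r; rewrite row_mul.
  case: (ltnP r j.+1) => rj; last first.
    rewrite (_ : row r _ = 0) ?mul0mx ?sub0mx //.
    by apply/rowP => e; rewrite !mxE ltnNge rj andbF.
  rewrite (_ : row r _ = delta_mx 0 r); last first.
    by apply/rowP => e; rewrite !mxE eqxx rj andbT eq_sym.
  rewrite mulmxA -(rowE _ (chart_mx t)); apply: (proj2 (AG i _)) => e de; apply: Ts.
  by apply: leq_trans de; apply: dmono.
Qed.

Lemma schubert_covered x : affine_schubert k.+1 A c x ->
  exists pi, valid_pivots d pi /\ exists t : 'I_(nfree d pi) -> R, x = chart t.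
Proof.
case=> P [v [[Pt PP Pr vP] -> capP]].
(* The directions shared with each flag member, in the coordinates of [G]; the incidence conditions
   give them dimension > i. *)
pose V (i : 'I_k.+1) := (P :&: A i.+1)%MS *m invmx G.
have Ginv : row_free (invmx G) by rewrite row_free_unit unitmx_inv.
have [||pi [T [TP TV]]] := @staircase_exists R k.+1 n d V.
- move=> i; rewrite mxrankMfree //.
  by have [_ [_ _]] := capP i.+1 (ltn_ord i).
- move=> i y yV; apply/AG.
  have := submxMr G yV; rewrite mulmxKV // => /submx_trans; apply.
  exact: capmxSr.
have Tf := staircase_row_free TP.
have Mf : row_free (T *m G) by rewrite /row_free mxrankMfree // row_free_unit.
have TGP : (T *m G <= P)%MS.
  apply/row_subP => i; rewrite row_mul.
  have := submxMr G (TV i); rewrite mulmxKV // => /submx_trans; apply.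
  exact: capmxSl.
have PE : P = orthoproj (T *m G).
  apply: projection_unique => //.
  - exact: orthoproj_tr.
  - exact: orthoproj_idem.
  apply: eqmx_trans (eqmx_sym (eqmx_orthoproj Mf)).
  apply/eqmxP; rewrite TGP andbT.
  by have := (mxrank_leqif_sup TGP).2; rewrite Pr (eqP Mf) eqxx => <-.
have piv : valid_pivots d pi.
  apply/andP; split; first exact/injectiveP/(staircase_pivot_inj TP).
  by apply/forallP => i; apply: staircase_pivot_lt TP.
have [T1 T0 Ts] := TP.
have [p [pP pA _]] := capP 1%N isT.
have /submxP[z pz] : (p - c 1%N <= invmx G *m G)%MS by rewrite mulVmx // submx1.
pose s0 := (p - c 1%N) *m invmx G.
have s0E : s0 *m G = p - c 1%N by rewrite mulmxKV.
have s0s : supported (d ord0) s0 by apply/(AG ord0); rewrite s0E.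
(* Sliding [p] along the first staircase row stays in the plane and in the first flag member, and
   makes the first pivot entry vanish. *)
pose s := s0 - s0 0 (pi ord0) *: row ord0 T.
have ss : supported (d ord0) s.
  by move=> e de; rewrite mxE s0s // mxE mxE (Ts ord0) // mulr0 subr0.
have spi : s 0 (pi ord0) = 0 by rewrite !mxE T1 mulr1 subrr.
have [|t tE] := @chart_entry_onto pi (fun o =>
    if unlift ord0 o.1 is Some i then T i o.2 - (o.2 == pi i)%:R else s 0 o.2).
  case=> o e; rewrite /free_pos /=; case: unliftP => [i _|_].
    rewrite negb_and negb_forall -leqNgt => /orP[de|/existsP[i']].
      have := Ts i e de; rewrite mxE => ->.
      case: eqP de => [->|]; last by rewrite subrr.
      by rewrite leqNgt (staircase_pivot_lt i TP).
    rewrite negb_imply negbK => /andP[i'i /eqP->].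
    have [->|i'Ni] := eqVneq i' i; first by rewrite T1 eqxx subrr.
    rewrite (inj_eq (staircase_pivot_inj TP)) (negPf i'Ni) subr0 T0 //.
    by rewrite ltn_neqAle i'i andbT.
  by rewrite negb_and negbK -leqNgt => /orP[/ss|/eqP->].
exists pi; split=> //; exists t.
have TE : chart_mx t = T.
  by apply/matrixP => i e; rewrite mxE tE /= liftK addrC subrK.
have sE : chart_shift t = s.
  by apply/rowP => e; rewrite mxE tE /= unlift_none.
rewrite /chart /chart_foot /chart_proj TE sE -PE; congr graff_coords.
(* The moved point and the foot differ by a direction of the plane, so both have the same image
   under 1 - P, which fixes [v]. *)
have vsub : ((b + s *m G) - v <= P)%MS.
  have -> : b + s *m G - v = (p - v) - s0 0 (pi ord0) *: row ord0 (T *m G).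
    rewrite bc mulmxBl s0E -scalemxAl row_mul.
    by rewrite addrA (addrC (c 1%N)) subrK addrAC.
  rewrite addmx_sub // eqmx_opp scalemx_sub //.
  by apply: submx_trans TGP; apply: row_sub.
have /submxP[w wE] := vsub.
have /eqP : (b + s *m G - v) *m (1%:M - P) = 0.
  by rewrite wE -mulmxA mulmxBr mulmx1 PP subrr mulmx0.
by rewrite mulmxBl subr_eq0 => /eqP->; rewrite mulmxBr mulmx1 vP subr0.
Qed.

End SchubertVariety.

End Chart.

(** * Assembly of the dimension formula *)

Lemma sum_triangular (R : numFieldType) k :
  \sum_(1 <= j < k.+1) j%:R = (k * (k + 1))%:R / 2 :> R.
Proof.
elim: k => [|k IHk]; first by rewrite big_geq // mul0n mul0r.
rewrite big_nat_recr //= IHk !natrM !natrD -[k.+1]addn1 natrD.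
by field.
Qed.

(** Both [b] and [b + row i M] lie in the larger affine space, so their difference is one of its
    directions. *)
Lemma affsp_subspace (R : realType) n (M M' : 'M[R]_n) b b' :
  (forall x, affsp M b x -> affsp M' b' x) -> (M <= M')%MS.
Proof.
move=> sub; apply/row_subP => i.
have -> : row i M = (b + row i M - b') - (b - b') 
  by rewrite opprB addrA subrK addrC addKr.
rewrite addmx_sub ?eqmx_opp //; apply: sub; rewrite /affsp.
  by rewrite addrC addKr row_sub.
by rewrite subrr sub0mx.
Qed.

Unset Implicit Arguments.

Theorem theorem6p5 (R : realType) (n k : nat) (d : nat -> nat)
    (A : nat -> 'M[R]_n) (b : nat -> 'rV[R]_n) :
  (0 < k)%N ->
  (1 <= d 1%N)%N ->
  (forall j, (1 <= j < k)%N -> (d j < d j.+1)%N) ->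
  (d k <= n)%N ->
  (forall j, (1 <= j <= k)%N -> \rank (A j) = d j) ->
  (forall j, (1 <= j < k)%N ->
     forall x, affsp (A j) (b j) x -> affsp (A j.+1) (b j.+1) x) ->
  exists D : nat,
    variety_dim_is (affine_schubert k A b) D /\
    (D%:R : R) = \sum_(1 <= j < k.+1) (d j)%:R - (k * (k + 1))%:R / 2
                 + ((d 1%N)%:R - 1).
Proof.
case: k => // k _ d1 dlt dn rankA flag.
pose d' (i : 'I_k.+1) := d i.+1.
have dltn i j : (i < j)%N -> (j <= k)%N -> (d i.+1 < d j.+1)%N.
  elim: j => // j IHj; rewrite ltnS leq_eqVlt => /orP[/eqP->|ij] jk.
    exact: dlt.
  by apply: ltn_trans (IHj ij (ltnW jk)) _; apply: dlt.
have d'lt : {homo d' : i j / (i < j)%N}.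
  by move=> i j ij; apply: dltn => //; rewrite -ltnS.
have d'le : {homo d' : i j / (i <= j)%N}.
  move=> i j; rewrite leq_eqVlt => /orP[/eqP/val_inj-> //|/d'lt]; exact: ltnW.
have d'n i : (d' i <= n)%N by apply: leq_trans (d'le i ord_max _) dn; apply: leq_ord.
(* This makes the truncated subtractions in [D] genuine and each [d' i] positive. *)
have dge j : (j <= k)%N -> (j.+1 <= d j.+1)%N.
  elim: j => // j IHj jk; apply: leq_ltn_trans (IHj (ltnW jk)) _.
  exact: dlt.
have [j jk|G Gunit GP] := @flag_adapted_basis R n (fun j => A j.+1) k.
  by apply: affsp_subspace (flag j.+1 _).
have AG (i : 'I_k.+1) y : (y *m G <= A i.+1)%MS <-> supported (d' i) y.
  rewrite /d' -rankA; last by rewrite ltn_ord.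
  by apply: GP; rewrite -ltnS.
have flag1 (i : 'I_k.+1) x : affsp (A 1%N) (b 1%N) x -> affsp (A i.+1) (b i.+1) x.
  case: i => i /=; elim: i x => // i IHi x ik /(IHi _ (ltnW ik)).
  exact: flag.
pose D := (\sum_(i < k.+1) (d' i - i.+1) + (d' ord0 - 1))%N.
have nfreeD (pi : 'I_k.+1 -> 'I_n) : valid_pivots d' pi -> nfree d' pi = D.
  by move=> piv; apply: nfreeE.
exists D; split; last first.
  rewrite /D natrD natrB // natr_sum; congr (_ + _).
  rewrite -sum_triangular -sumrB big_add1 /= big_mkord.
  by apply: eq_bigr => i _; rewrite natrB // dge // -ltnS.
split.
  have pi0n (i : 'I_k.+1) : ((d' i).-1 < n)%N.
    by rewrite prednK ?d'n // (leq_trans _ (dge i _)) // -ltnS.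
  (* The rightmost pivots: row i has its pivot in the last column allowed to it. *)
  pose pi0 i := Ordinal (pi0n i).
  have pi0d i : (pi0 i).+1 = d' i.
    by rewrite /= prednK // (leq_trans _ (dge i _)) // -ltnS.
  have piv : valid_pivots d' pi0.
    apply/andP; split; last by apply/forallP => i; rewrite -pi0d.
    apply/injectiveP => i j pij; apply: val_inj.
    by case: (ltngtP i j) => // /d'lt; rewrite -!pi0d pij ltnn.
  rewrite -(nfreeD _ piv).
  have [u [w [w0 uE]]] := chart_inverse (b 1%N) Gunit d'lt pi0d.
  apply: (ratmap_chain (ratmap_chart (b 1%N) Gunit piv) _ w0 uE) => t.
  exact: chart_in_schubert.
move=> m C.
(* Pivot choices are taken as finite functions, so that the charts are indexed by a finite type. *)
apply: (@prime_chain_leq _ _ _ {p : {ffun 'I_k.+1 -> 'I_n} | valid_pivots d' p}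
  (fun pi => nfree d' (val pi)) _ (fun pi => chart G (b 1%N) (pi := val pi))
  (fun pi t => \det (chart_gram G t))).
- by move=> pi; apply: ratmap_chart => //; apply: (valP pi).
- by move=> pi; rewrite (nfreeD _ (valP pi)).
- move=> x /(schubert_covered Gunit AG erefl)[pi [piv [t ->]]].
  have piE : [ffun i => pi i] = pi :> ('I_k.+1 -> 'I_n).
    by apply: funext => i; rewrite ffunE.
  move: (piv) t; rewrite -piE => piv' t.
  by exists (exist (fun p : {ffun 'I_k.+1 -> 'I_n} => valid_pivots d' p) _ piv'), t.
Qed.
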